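(* Let $m\ge 3$ and $n\ge 2$. For every positive integer $k$, $$\chi^b_{B_1(m,n)}(2k)=\Big[\sum_{i=0}^{m-2}(-1)^i(2k-1)^{(m-2)-i}\Big]\,\chi^b_{B_1(m,n-1)}(2k).$$
   Context: A signed graph $(G,\sigma)$ is a finite graph $G$ with a sign function $\sigma:E(G)\to\{+1,-1\}$; its signature is the set of negative edges. A zero-free signed coloring in $2k$ colors is a map $c:V(G)\to\{-k,\dots,-1,1,\dots,k\}$; it is proper if $c(y)\neq\sigma(e)c(x)$ for every edge $e=xy$. The balanced chromatic polynomial $\chi^b_{(G,\sigma)}(2k)$ is the number of proper zero-free signed colorings in $2k$ colors. For integers $m\ge 3$, $n\ge 1$, the Book graph $B(m,n)$ has vertex set $\{u,v\}\cup\{u_j^l:1\le l\le n,\,1\le j\le m-2\}$ and consists of the $n$ cycles $u\,u_1^l\cdots u_{m-2}^l\,v\,u$ sharing the edge $uv$. For $1\le l\le n$, $B_l(m,n)$ denotes $B(m,n)$ with signature $\{uu_1^1,\dots,uu_1^l\}$. *)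

(* Defs.v *)
From mathcomp Require Import all_boot all_order all_algebra.

Set Implicit Arguments.
Unset Strict Implicit.
Unset Printing Implicit Defensive.

Import GRing.Theory Num.Theory.

Local Open Scope ring_scope.

(* Finite graphs in the generality usual for signed graphs: parallel edges and
   loops are allowed.  The order of the two ends of an edge carries no meaning;
   it only fixes which end is called x and which is called y in e = xy. *)
Record graph := Graph {
  vertex : finType;
  edge : finType;
  ends : edge -> vertex * vertex
}.

Record signed_graph := SignedGraph {
  underlying :> graph;
  sign : edge underlying -> int;
  signP : forall e, sign e = 1 \/ sign e = -1
}.

Definition signature (G : signed_graph) : {set edge G} :=
  [set e | sign e == -1].

Definition sign_of_signature (G : graph) (N : {set edge G}) (e : edge G) : int :=
  if e \in N then -1 else 1.

Lemma sign_of_signatureP (G : graph) (N : {set edge G}) (e : edge G) :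
  sign_of_signature N e = 1 \/ sign_of_signature N e = -1.
Proof. by rewrite /sign_of_signature; case: ifP; [right | left]. Qed.

Definition with_signature (G : graph) (N : {set edge G}) : signed_graph :=
  SignedGraph (sign_of_signatureP N).

Lemma signature_with_signature (G : graph) (N : {set edge G}) :
  signature (with_signature N) = N.
Proof.
by apply/setP=> e; rewrite inE /= /sign_of_signature; case: (e \in N).
Qed.

Definition zero_free_colors (k : nat) : seq int :=
  [seq - i%:Z | i <- iota 1 k] ++ [seq i%:Z | i <- iota 1 k].

Definition zero_free_color (k : nat) : finType := seq_sub (zero_free_colors k).

Definition zero_free_coloring (G : graph) (k : nat) : finType :=
  {ffun vertex G -> zero_free_color k}.

(* As signs are +1 or -1, the condition does not depend on the order of the
   ends of e. *)
Definition proper_coloring (G : signed_graph) (k : nat)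
    (c : zero_free_coloring G k) : bool :=
  [forall e : edge G,
     val (c (ends e).2) != sign e * val (c (ends e).1)].

(* The value of the balanced chromatic polynomial at 2k. *)
Definition balanced_chrom (G : signed_graph) (k : nat) : nat :=
  #|[set c : zero_free_coloring G k | proper_coloring c]|.

(* inl false is u, inl true is v, and inr (l, j) is u_{j+1}^{l+1}. *)
Definition book_vertex (m n : nat) : finType := (bool + 'I_n * 'I_(m - 2))%type.

Definition book_u (m n : nat) : book_vertex m n := inl false.
Definition book_v (m n : nat) : book_vertex m n := inl true.

(* The vertex in position j of the path u, u_1^l, ..., u_{m-2}^l, v, whose
   positions are 0, ..., m - 1. *)
Definition book_path (m n : nat) (l : 'I_n) (j : nat) : book_vertex m n :=
  if j is i.+1 then
    if insub i is Some i' then inr (l, i') else book_v m n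
  else book_u m n.

(* None is the common edge uv; Some (l, j) is the edge joining the positions j
   and j + 1 of the l-th path. *)
Definition book_edge (m n : nat) : finType := option ('I_n * 'I_(m - 1)).

Definition book_ends (m n : nat) (e : book_edge m n) :
    book_vertex m n * book_vertex m n :=
  if e is Some (l, j) then (book_path m l j, book_path m l j.+1)
  else (book_u m n, book_v m n).

Definition book (m n : nat) : graph := Graph (@book_ends m n).

(* The edges u u_1^1, ..., u u_1^l. *)
Definition book_signature (m n l : nat) : {set edge (book m n)} :=
  [set e : book_edge m n |
     if e is Some (i, j) then (i < l)%N && (j == 0%N :> nat) else false].

Definition signed_book (l m n : nat) : signed_graph :=
  with_signature (book_signature m n l).

(* Main.v *)
Require Import Defs.
From mathcomp Require Import all_boot all_order all_algebra.
From mathcomp Require Import ring zify.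

Set Implicit Arguments.
Unset Strict Implicit.
Unset Printing Implicit Defensive.

Import GRing.Theory.

Local Open Scope ring_scope.

(** The last page of [B_1(m, n)], [n >= 2], has only positive edges.  Hence a
proper coloring of [B_1(m, n)] is a proper coloring of [B_1(m, n - 1)] together
with a walk of [m - 1] steps from the color of [u] to the color of [v] in the
complete graph on the [2k] colors.  The edge [uv] is positive, so these two
colors differ, and the number of such walks is the alternating sum whatever
the two colors are. *)

Lemma sum_tuple_cons (C : finType) (R : nmodType) (N : nat)
    (P : pred (N.+1.-tuple C)) (F : N.+1.-tuple C -> R) :
  \sum_(t | P t) F t =
  \sum_x \sum_(t : N.-tuple C | P [tuple of x :: t]) F [tuple of x :: t].
Proof.
rewrite (pair_big_dep xpredT (fun x (t : N.-tuple C) => P [tuple of x :: t])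
  (fun x (t : N.-tuple C) => F [tuple of x :: t])) /=.
rewrite (reindex (fun p : C * N.-tuple C => [tuple of p.1 :: p.2])) //=.
exists (fun t => (thead t, [tuple of behead t])) => [[x t] _ | t _] /=.
  by rewrite theadE; congr (_, _); apply/val_inj.
by rewrite -tuple_eta.
Qed.

(** Times [x + 1] this is [x ^+ N.+1 + (-1) ^+ N]; for [x = #|C| - 1] it is the usual count of walks
    of length [N.+1] between two distinct vertices of a complete graph on [C]. *)
Definition alternating_power_sum (R : pzRingType) (x : R) (N : nat) : R :=
  \sum_(0 <= i < N.+1) (-1) ^+ i * x ^+ (N - i)%N.

Lemma alternating_power_sumS (R : pzRingType) (x : R) (N : nat) :
  alternating_power_sum x N.+1 = x ^+ N.+1 - alternating_power_sum x N.
Proof.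
rewrite /alternating_power_sum big_nat_recl // expr0 mul1r subn0.
congr (_ + _); rewrite -sumrN; apply: eq_bigr => i _.
by rewrite subSS exprS mulN1r mulNr.
Qed.

(* The case [a = b] is needed to carry the induction through. *)
Lemma count_complete_walks (C : finType) (N : nat) (a b : C)
    (q := #|C|%:Z - 1) :
  \sum_(t : N.-tuple C | path (fun x y => y != x) a (rcons t b)) 1 =
  if a == b then q ^+ N.+1 - q * alternating_power_sum q N
  else alternating_power_sum q N.
Proof.
elim: N a => [|N IHN] a.
  rewrite /alternating_power_sum big_nat1 subnn expr0 mulr1 expr1.
  rewrite (eq_bigl (fun=> a != b)) => [|t]; last first.
    by rewrite (tuple0 t) /= andbT eq_sym.
  case: eqP => _ /=; first by rewrite big_pred0_eq subrr.
  by rewrite sumr_const card_tuple expn0.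
rewrite sum_tuple_cons alternating_power_sumS.
(* Split by the first vertex [x], which must differ from [a]; the rest is a walk from [x] to [b],
   closed or open according to [x == b]. *)
have inner x : \sum_(t : N.-tuple C | path (fun x y => y != x) a
      (rcons [tuple of x :: t] b)) 1 =
    if x != a then if x == b then q ^+ N.+1 - q * alternating_power_sum q N
                   else alternating_power_sum q N else 0.
  by case: ifP => /= xa; [rewrite -IHN; apply: eq_bigl | apply: big_pred0] => t;
    rewrite xa.
rewrite (eq_bigr _ (fun x _ => inner x)) -big_mkcond /=.
case: eqP => [<- | /eqP neq_ab].
  (* Closed walks: each of the [q] choices of [x] differs from the endpoint, so the total is [q]
     times the open count. *)
  rewrite (eq_bigr (fun=> alternating_power_sum q N)); last first.
    by move=> x /negPf ->.
  rewrite sumr_const cardC1 -mulr_natl.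
  have -> : (#|C|.-1)%:R = q.
    by rewrite /q -[#|C|]prednK ?natz; [lia | apply/card_gt0P; exists a].
  by rewrite [in RHS]exprS; ring.
(* Open walks: [x = b] leaves a closed walk, and the other [q - 1] choices leave open ones; the
   total collapses to [q ^+ N.+1] minus the previous alternating sum. *)
rewrite (bigD1 b) 1?eq_sym //= eqxx.
rewrite (eq_bigr (fun=> alternating_power_sum q N)); last first.
  by move=> x /andP[_ /negPf ->].
rewrite sumr_const -mulr_natl.
have -> : #|[pred x | (x != a) && (x != b)]|%:R = q - 1.
  have := cardC (pred2 a b); rewrite card2 neq_ab /q => <-.
  rewrite (@eq_card _ [pred x | (x != a) && (x != b)] [predC pred2 a b]).
    by rewrite natz PoszD -addrA -opprD addrAC subrr add0r.
  by move=> x; rewrite !inE negb_or.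
ring.
Qed.

Lemma card_zero_free_color (k : nat) : #|zero_free_color k| = (2 * k)%N.
Proof.
rewrite card_seq_sub /zero_free_colors; last first.
  rewrite cat_uniq !map_inj_uniq ?iota_uniq; last 2 first.
  - by move=> i j [].
  - by move=> i j /oppr_inj [].
  (* The negative and positive halves are disjoint because both index ranges start at 1. *)
  rewrite andbT /=; apply/hasPn => z /mapP[i]; rewrite mem_iota => hi ->.
  by apply/negP => /mapP[j]; rewrite mem_iota; lia.
by rewrite size_cat !size_map !size_iota; lia.
Qed.

Section AddPage.

Variables (m n : nat) (T : Type).

(** The new page gets the index [ord_max], so [lift ord_max] keeps the numbers of the old pages and
    the negative edge stays on the first page. *)
Definition add_page (c : {ffun book_vertex m n -> T}) (t : (m - 2).-tuple T) :
    {ffun book_vertex m n.+1 -> T} :=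
  [ffun x => match x with
             | inl b => c (inl b)
             | inr (l, j) =>
                 if unlift ord_max l is Some l' then c (inr (l', j))
                 else tnth t j
             end].

Definition remove_page (c : {ffun book_vertex m n.+1 -> T}) :
    {ffun book_vertex m n -> T} * (m - 2).-tuple T :=
  ([ffun x => match x with
              | inl b => c (inl b)
              | inr (l, j) => c (inr (lift ord_max l, j))
              end],
   [tuple c (inr (ord_max, j)) | j < m - 2]).

Lemma add_pageK c t : remove_page (add_page c t) = (c, t).
Proof.
congr (_, _).
  by apply/ffunP => -[b|[l j]]; rewrite !ffunE ?liftK.
by apply: eq_from_tnth => j; rewrite tnth_mktuple ffunE unlift_none.
Qed.

Lemma remove_pageK c : add_page (remove_page c).1 (remove_page c).2 = c.
Proof.
apply/ffunP => -[b|[l j]]; rewrite !ffunE //.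
by case: unliftP => [l'|] ->; rewrite ?ffunE ?tnth_mktuple.
Qed.

Lemma add_page_old c t (l : 'I_n) j :
  add_page c t (book_path m (lift ord_max l) j) = c (book_path m l j).
Proof.
by case: j => [|j] /=; [|case: insubP => [j' _ _|_]]; rewrite ffunE ?liftK.
Qed.

Lemma add_page_new c t j : (j < m)%N ->
  add_page c t (book_path m ord_max j) =
  nth (c (book_v m n)) (c (book_u m n) :: rcons t (c (book_v m n))) j.
Proof.
move=> hj; case: j hj => [|j] /= hj; first by rewrite ffunE.
rewrite nth_rcons size_tuple.
case: insubP => [j' hj' def_j|hj']; rewrite ffunE.
  by rewrite unlift_none -def_j ltn_ord (tnth_nth (c (book_v m n))).
(* Past the interior vertices [book_path] gives v, and the default of [nth] is the color of v too,
   so both remaining branches agree. *)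
by rewrite (negPf hj') if_same.
Qed.

End AddPage.

Local Arguments book_path : simpl never.

(** The edges fall into three classes: uv, the old pages with unchanged signs, and the new page,
    which is all positive since its index [n] is at least 1. *)
Lemma proper_add_page (m n k : nat) (hm : (2 <= m)%N) (hn : (0 < n)%N)
    (c : zero_free_coloring (signed_book 1 m n) k)
    (t : (m - 2).-tuple (zero_free_color k)) :
  proper_coloring (add_page c t : zero_free_coloring (signed_book 1 m n.+1) k) =
  proper_coloring c &&
  path (fun x y => y != x) (c (book_u m n)) (rcons t (c (book_v m n))).
Proof.
have uv (d := add_page c t : zero_free_coloring (signed_book 1 m n.+1) k) :
    (val (d (book_v m n.+1)) !=
       sign (None : edge (signed_book 1 m n.+1)) * val (d (book_u m n.+1))) =
    (val (c (book_v m n)) !=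
       sign (None : edge (signed_book 1 m n)) * val (c (book_u m n))).
  by rewrite /= !ffunE /sign_of_signature !inE.
apply/forallP/andP => [prop | [/forallP prop /(pathP (c (book_v m n))) walk]].
  split.
    apply/forallP => -[[l j]|]; last by have := prop None; rewrite /= uv.
    have := prop (Some (lift ord_max l, j)).
    by rewrite /= !add_page_old /sign_of_signature !inE lift_max.
  apply/(pathP (c (book_v m n))) => i; rewrite size_rcons size_tuple => hi.
  (* The [m - 2] interior vertices give [m - 1] steps, and step [i] of the walk is edge [i] of the
     new page. *)
  have hi' : (i < m - 1)%N by lia.
  have := prop (Some (ord_max, Ordinal hi')).
  rewrite /= !add_page_new; try lia.
  by rewrite /sign_of_signature !inE /= ltnNge hn mul1r (inj_eq val_inj).
case=> [[l j]|]; last by rewrite /= uv; exact: (prop None).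
rewrite /=; case: (unliftP ord_max l) => [l'|] ->.
  have := prop (Some (l', j)).
  by rewrite /= !add_page_old /sign_of_signature !inE lift_max.
have hj := ltn_ord j.
rewrite !add_page_new; try lia.
rewrite /sign_of_signature !inE /= ltnNge hn mul1r (inj_eq val_inj).
by apply: walk; rewrite size_rcons size_tuple; lia.
Qed.

Lemma balanced_chrom_add_page (m n k : nat) (hm : (2 <= m)%N) (hn : (0 < n)%N) :
  (balanced_chrom (signed_book 1 m n.+1) k)%:Z =
  alternating_power_sum ((2 * k)%:Z - 1) (m - 2) *
  (balanced_chrom (signed_book 1 m n) k)%:Z.
Proof.
have card_sum (T : finType) (A : {set T}) : #|A|%:Z = \sum_(x in A) 1.
  by rewrite sumr_const natz.
rewrite /balanced_chrom !card_sum.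
rewrite (reindex (fun p : zero_free_coloring (signed_book 1 m n) k *
                          (m - 2).-tuple (zero_free_color k) =>
                    add_page p.1 p.2)) /=; last first.
  by exists (@remove_page m n _) => [[c t] _ | c _];
    rewrite ?add_pageK ?remove_pageK.
under eq_bigl => p do rewrite inE proper_add_page //.
rewrite -(pair_big_dep
  (fun c : zero_free_coloring (signed_book 1 m n) k => proper_coloring c)
  (fun c (t : (m - 2).-tuple (zero_free_color k)) =>
     path (fun x y => y != x) (c (book_u m n)) (rcons t (c (book_v m n))))
  (fun _ _ => 1)) /=.
rewrite mulr_sumr; apply: eq_big => [c | c proper_c]; first by rewrite inE.
rewrite count_complete_walks card_zero_free_color mulr1 ifN //.
(* Properness at the positive edge uv selects the case of distinct endpoints, so every [c] has the
   same number of extensions. *)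
have /forallP/(_ None) := proper_c.
by rewrite /= /sign_of_signature inE mul1r (inj_eq val_inj) eq_sym.
Qed.

Theorem theorem7p6 (m n : nat) (hm : (3 <= m)%N) (hn : (2 <= n)%N)
  (k : nat) (hk : (0 < k)%N) :
  (balanced_chrom (signed_book 1 m n) k)%:Z =
  (\sum_(0 <= i < (m - 2).+1)
      (-1) ^+ i * ((2 * k)%:Z - 1) ^+ ((m - 2) - i)%N) *
  (balanced_chrom (signed_book 1 m (n - 1)) k)%:Z.
Proof.
case: n hn => // n hn; rewrite subn1 /=.
by apply: balanced_chrom_add_page; rewrite // ltnW.
Qed.
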